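(* Let $m\in\mathbb N$ and let $\boxtimes$ be a monoidal product with embeddings on $\mathfrak{PreHilb}$. Let $\odot$ be an $m$-faced universal product of $\ast$-representations for $\boxtimes$. Then there exists an $m$-faced universal product of states, also denoted $\odot$, such that the following holds: whenever $A_1,A_2$ are $m$-faced $\ast$-algebras, $\phi_k$ is a state on $A_k$ and $\pi_k\colon A_k\to L_{\mathrm a}(H_k)$ is a $\ast$-representation with $\phi_k(\cdot)=\langle\Omega,\pi_k(\cdot)\Omega\rangle$ on $A_k$ for $k=1,2$, then $$(\phi_1\odot\phi_2)(\cdot)=\langle\Omega,(\pi_1\odot\pi_2)(\cdot)\Omega\rangle\quad\text{on } A_1\sqcup A_2.$$
   Context: Pre-Hilbert spaces. All pre-Hilbert spaces are complex, with inner product linear in the second argument, and equipped with a distinguished unit vector, always denoted $\Omega$. $L_{\mathrm a}(H)$ is the $\ast$-algebra of adjointable linear operators on $H$. $\mathfrak{PreHilb}$ is the category of such pre-Hilbert spaces; its arrows are the (possibly non-adjointable) linear isometries $W\colon H\to G$ with $W\Omega=\Omega$. Monoidal product with embeddings. This is a bifunctor $\boxtimes\colon\mathfrak{PreHilb}\times\mathfrak{PreHilb}\to\mathfrak{PreHilb}$ with natural associativity and unitality isomorphisms making $(\mathfrak{PreHilb},\boxtimes)$ a monoidal category whose unit object is an initial object (so it is $\mathbb C\Omega$). It yields canonical arrows $H_1\cong H_1\boxtimes\mathbb C\Omega\to H_1\boxtimes H_2$ and $H_2\cong\mathbb C\Omega\boxtimes H_2\to H_1\boxtimes H_2$, through which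 $H_1,H_2$ are regarded as subspaces of $H_1\boxtimes H_2$. One identifies $H\boxtimes\mathbb C\Omega=H=\mathbb C\Omega\boxtimes H$ and $H_1\boxtimes(H_2\boxtimes H_3)=(H_1\boxtimes H_2)\boxtimes H_3$. $\ast$-algebras and states. $\ast$-algebras are over $\mathbb C$ and not assumed unital. A linear functional $\phi$ on a $\ast$-algebra $A$ is a state if its unital extension to the unitization $\mathbb C1\oplus A$ is positive (nonnegative on all $a^*a$). $A_1\sqcup A_2$ is the non-unital free product (coproduct of $\ast$-algebras), containing $A_1,A_2$; $j_1\sqcup j_2$ denotes the induced $\ast$-homomorphism $B_1\sqcup B_2\to A_1\sqcup A_2$ of $\ast$-homomorphisms $j_k\colon B_k\to A_k$. Iterated free products are identified via associativity. A $\ast$-representation of $A$ is a $\ast$-homomorphism $\pi\colon A\to L_{\mathrm a}(H)$. Faces. An $m$-faced $\ast$-algebra is a $\ast$-algebra $A$ together with $\ast$-subalgebras $A^{(1)},\dots,A^{(m)}$ freely generating it, i.e. the canonical map $A^{(1)}\sqcup\dots\sqcup A^{(m)}\to A$ is an isomorphism. An $m$-faced $\ast$-homomorphism $j\colon A\to B$ is a $\ast$-homomorphism with $j(A^{(k)})\subset B^{(k)}$ for all $k$. $A_1\sqcup A_2$ is $m$-faced with $(A_1\sqcup A_2)^{(k)}=A_1^{(k)}\sqcup A_2^{(k)}$. $m$-faced universal product of states: an operation $\odot$ assigning to states $\phi_1,\phi_2$ on $m$-faced $\ast$-algebras $A_1,A_2$ a state $\phi_1\odot\phi_2$ on $A_1\sqcup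 A_2$ such that $\phi_1\odot(\phi_2\odot\phi_3)=(\phi_1\odot\phi_2)\odot\phi_3$; $(\phi_1\circ j_1)\odot(\phi_2\circ j_2)=(\phi_1\odot\phi_2)\circ(j_1\sqcup j_2)$ for all $m$-faced $\ast$-homomorphisms $j_k\colon B_k\to A_k$; and $(\phi_1\odot\phi_2)|_{A_k}=\phi_k$ for $k=1,2$. $m$-faced universal product of $\ast$-representations for $\boxtimes$: a rule assigning to any $\ast$-representations $\pi_k\colon A_k\to L_{\mathrm a}(H_k)$ of $m$-faced $\ast$-algebras ($k=1,2$) a $\ast$-representation $\pi_1\odot\pi_2\colon A_1\sqcup A_2\to L_{\mathrm a}(H_1\boxtimes H_2)$ such that: (associativity) $\pi_1\odot(\pi_2\odot\pi_3)=(\pi_1\odot\pi_2)\odot\pi_3$; (universality of $m$-faced $\ast$-algebras) $(\pi_1\odot\pi_2)\circ(j_1\sqcup j_2)=(\pi_1\circ j_1)\odot(\pi_2\circ j_2)$ for all $m$-faced $\ast$-homomorphisms $j_k\colon B_k\to A_k$; (universality of pre-Hilbert spaces) if $W_k\colon H_k\to G_k$ are arrows and $\pi_k\colon A_k\to L_{\mathrm a}(H_k)$, $\sigma_k\colon A_k\to L_{\mathrm a}(G_k)$ are $\ast$-representations with $W_k\pi_k(a)=\sigma_k(a)W_k$ for all $a\in A_k$, $k=1,2$, then $(W_1\boxtimes W_2)(\pi_1\odot\pi_2)(a)=(\sigma_1\odot\sigma_2)(a)(W_1\boxtimes W_2)$ for all $a\in A_1\sqcup A_2$; (restriction) $(\pi_1\odot\pi_2)(a)|_{H_k}=\pi_k(a)$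 for $a\in A_k$, $k=1,2$. *)

(* Defs.v *)
From HB Require Import structures.
From mathcomp Require Import all_boot all_order all_algebra generic_quotient.
From mathcomp Require Import boolp classical_sets functions reals.
From mathcomp.real_closed Require Export complex.

Set Implicit Arguments.
Unset Strict Implicit.
Unset Printing Implicit Defensive.

Import Order.TTheory GRing.Theory Num.Theory.
Local Open Scope ring_scope.
Local Open Scope quotient_scope.

(* The order on R[i] satisfies 0 <= z iff z is a nonnegative real number.     *)
HB.mixin Record Lmodule_isPreHilb (R : realType) H of GRing.Lmodule R[i] H := {
  inner : H -> H -> R[i];
  innerDr : forall x y z, inner x (y + z) = inner x y + inner x z;
  innerZr : forall x (c : R[i]) y, inner x (c *: y) = c * inner x y;
  innerC : forall x y, inner y x = Num.conj (inner x y);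
  inner_ge0 : forall x, 0 <= inner x x;
  inner_eq0 : forall x, inner x x = 0 -> x = 0;
  Omega : H;
  inner_Omega : inner Omega Omega = 1
}.

#[short(type="preHilbType")]
HB.structure Definition PreHilb (R : realType) :=
  { H of GRing.Lmodule R[i] H & Lmodule_isPreHilb R H }.

Arguments Omega {R s}.

HB.mixin Record Lmodule_isStarAlg (R : realType) A of GRing.Lmodule R[i] A := {
  smul : A -> A -> A;
  star : A -> A;
  smulA : associative smul;
  smulDl : left_distributive smul +%R;
  smulDr : right_distributive smul +%R;
  smulZl : forall (c : R[i]) x y, smul (c *: x) y = c *: smul x y;
  smulZr : forall (c : R[i]) x y, smul x (c *: y) = c *: smul x y;
  starD : {morph star : x y / x + y};
  starZ : forall (c : R[i]) x, star (c *: x) = Num.conj c *: star x;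
  starM : forall x y, star (smul x y) = smul (star y) (star x);
  starK : involutive star
}.

#[short(type="starAlgType")]
HB.structure Definition StarAlg (R : realType) :=
  { A of GRing.Lmodule R[i] A & Lmodule_isStarAlg R A }.

Record starHom (R : realType) (A B : starAlgType R) := StarHom {
  starHom_fun :> {linear A -> B};
  starHomM : {morph starHom_fun : x y / smul x y};
  starHomS : {morph starHom_fun : x / star x}
}.

Section StarHomTheory.
Variable R : realType.

Definition starHom_id (A : starAlgType R) : starHom A A :=
  @StarHom R A A idfun (fun _ _ => erefl) (fun _ => erefl).

Section Comp.
Variables (A B C : starAlgType R) (g : starHom B C) (f : starHom A B).

Fact starHom_compM : {morph g \o f : x y / smul x y}.
Proof. by move=> x y /=; rewrite !starHomM. Qed.
Fact starHom_compS : {morph g \o f : x / star x}.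
Proof. by move=> x /=; rewrite !starHomS. Qed.

Definition starHom_comp : starHom A C :=
  @StarHom R A C (g \o f) starHom_compM starHom_compS.
End Comp.

End StarHomTheory.

Section SubStarAlg.
Variables (R : realType) (A : starAlgType R).

Record subStarAlg := SubStarAlg {
  subset_of :> set A;
  sub0 : subset_of 0;
  subD : forall x y, subset_of x -> subset_of y -> subset_of (x + y);
  subZ : forall (c : R[i]) x, subset_of x -> subset_of (c *: x);
  subM : forall x y, subset_of x -> subset_of y -> subset_of (smul x y);
  subS : forall x, subset_of x -> subset_of (star x)
}.

Variable S : subStarAlg.

Definition sub_pred : {pred A} := fun x => `[< subset_of S x >].

Fact sub_pred_closed : submod_closed sub_pred.
Proof.
split; first by apply/asboolP; exact: sub0.
move=> c x y /asboolP xS /asboolP yS; apply/asboolP.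
by apply: subD => //; apply: subZ.
Qed.
HB.instance Definition _ :=
  GRing.isSubmodClosed.Build R[i] A sub_pred sub_pred_closed.

Record subAlg := SubAlg { subAlg_val : A; subAlg_in : subAlg_val \in sub_pred }.
HB.instance Definition _ := [isSub for subAlg_val].
HB.instance Definition _ := [Choice of subAlg by <:].
HB.instance Definition _ := [SubChoice_isSubLmodule of subAlg by <:].

Lemma subAlgP (x : subAlg) : subset_of S (val x).
Proof. by case: x => a /= /asboolP. Qed.

Fact subAlg_mulP (x y : subAlg) : smul (val x) (val y) \in sub_pred.
Proof. by apply/asboolP/subM; exact: subAlgP. Qed.
Fact subAlg_starP (x : subAlg) : star (val x) \in sub_pred.
Proof. by apply/asboolP/subS; exact: subAlgP. Qed.

Let mul x y := SubAlg (subAlg_mulP x y).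
Let st x := SubAlg (subAlg_starP x).

Fact subAlg_mulA : associative mul.
Proof. by move=> x y z; apply: val_inj; rewrite /= smulA. Qed.
Fact subAlg_mulDl : left_distributive mul +%R.
Proof. by move=> x y z; apply: val_inj; rewrite /= smulDl. Qed.
Fact subAlg_mulDr : right_distributive mul +%R.
Proof. by move=> x y z; apply: val_inj; rewrite /= smulDr. Qed.
Fact subAlg_mulZl (c : R[i]) x y : mul (c *: x) y = c *: mul x y.
Proof. by apply: val_inj; rewrite /= smulZl. Qed.
Fact subAlg_mulZr (c : R[i]) x y : mul x (c *: y) = c *: mul x y.
Proof. by apply: val_inj; rewrite /= smulZr. Qed.
Fact subAlg_starD : {morph st : x y / x + y}.
Proof. by move=> x y; apply: val_inj; rewrite /= starD. Qed.
Fact subAlg_starZ (c : R[i]) x : st (c *: x) = Num.conj c *: st x.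
Proof. by apply: val_inj; rewrite /= starZ. Qed.
Fact subAlg_starM x y : st (mul x y) = mul (st y) (st x).
Proof. by apply: val_inj; rewrite /= starM. Qed.
Fact subAlg_starK : involutive st.
Proof. by move=> x; apply: val_inj; rewrite /= starK. Qed.

HB.instance Definition _ := Lmodule_isStarAlg.Build R subAlg
  subAlg_mulA subAlg_mulDl subAlg_mulDr subAlg_mulZl subAlg_mulZr
  subAlg_starD subAlg_starZ subAlg_starM subAlg_starK.

Definition subAlg_incl : starHom subAlg A :=
  @StarHom R subAlg A val (fun _ _ => erefl) (fun _ => erefl).

End SubStarAlg.

Section StarHomImage.
Variables (R : realType) (A B : starAlgType R) (f : starHom A B).

Let im : set B := [set y | exists x, f x = y].

Fact image0 : im 0.
Proof. by exists 0; rewrite linear0. Qed.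
Fact imageD x y : im x -> im y -> im (x + y).
Proof. by move=> [a <-] [b <-]; exists (a + b); rewrite linearD. Qed.
Fact imageZ (c : R[i]) x : im x -> im (c *: x).
Proof. by move=> [a <-]; exists (c *: a); rewrite linearZ. Qed.
Fact imageM x y : im x -> im y -> im (smul x y).
Proof. by move=> [a <-] [b <-]; exists (smul a b); rewrite starHomM. Qed.
Fact imageS x : im x -> im (star x).
Proof. by move=> [a <-]; exists (star a); rewrite starHomS. Qed.

Definition starHom_image : subStarAlg B :=
  SubStarAlg image0 imageD imageZ imageM imageS.

End StarHomImage.

(* Free products (coproducts of non-unital star-algebras) as formal terms in  *)
(* elements of the factors modulo the congruence generated by the axioms of   *)
(* star-algebras and the operations of the factors; freeProd_lift and         *)
(* freeProd_hom_ext below give the universal property.                        *)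
Section FreeProduct.
Variables (R : realType) (I : Type) (A : I -> starAlgType R).

Inductive fpTerm :=
  | FpGen i (a : A i)
  | FpZero
  | FpAdd (s t : fpTerm)
  | FpScale (c : R[i]) (s : fpTerm)
  | FpMul (s t : fpTerm)
  | FpStar (s : fpTerm).

Inductive fpEq : fpTerm -> fpTerm -> Prop :=
  | fpEq_refl s : fpEq s s
  | fpEq_sym s t : fpEq s t -> fpEq t s
  | fpEq_trans s t u : fpEq s t -> fpEq t u -> fpEq s u
  | fpEq_add s s' t t' : fpEq s s' -> fpEq t t' -> fpEq (FpAdd s t) (FpAdd s' t')
  | fpEq_scale c s s' : fpEq s s' -> fpEq (FpScale c s) (FpScale c s')
  | fpEq_mul s s' t t' : fpEq s s' -> fpEq t t' -> fpEq (FpMul s t) (FpMul s' t')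
  | fpEq_star s s' : fpEq s s' -> fpEq (FpStar s) (FpStar s')
  | fpEq_genD i (a b : A i) : fpEq (FpGen (a + b)) (FpAdd (FpGen a) (FpGen b))
  | fpEq_genZ i c (a : A i) : fpEq (FpGen (c *: a)) (FpScale c (FpGen a))
  | fpEq_genM i (a b : A i) : fpEq (FpGen (smul a b)) (FpMul (FpGen a) (FpGen b))
  | fpEq_genS i (a : A i) : fpEq (FpGen (star a)) (FpStar (FpGen a))
  | fpEq_addA s t u : fpEq (FpAdd s (FpAdd t u)) (FpAdd (FpAdd s t) u)
  | fpEq_addC s t : fpEq (FpAdd s t) (FpAdd t s)
  | fpEq_add0 s : fpEq (FpAdd FpZero s) s
  | fpEq_addN s : fpEq (FpAdd (FpScale (-1) s) s) FpZero
  | fpEq_scaleA c d s : fpEq (FpScale c (FpScale d s)) (FpScale (c * d) s)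
  | fpEq_scale1 s : fpEq (FpScale 1 s) s
  | fpEq_scaleDr c s t :
      fpEq (FpScale c (FpAdd s t)) (FpAdd (FpScale c s) (FpScale c t))
  | fpEq_scaleDl c d s :
      fpEq (FpScale (c + d) s) (FpAdd (FpScale c s) (FpScale d s))
  | fpEq_mulA s t u : fpEq (FpMul s (FpMul t u)) (FpMul (FpMul s t) u)
  | fpEq_mulDl s t u :
      fpEq (FpMul (FpAdd s t) u) (FpAdd (FpMul s u) (FpMul t u))
  | fpEq_mulDr s t u :
      fpEq (FpMul s (FpAdd t u)) (FpAdd (FpMul s t) (FpMul s u))
  | fpEq_mulZl c s t : fpEq (FpMul (FpScale c s) t) (FpScale c (FpMul s t))
  | fpEq_mulZr c s t : fpEq (FpMul s (FpScale c t)) (FpScale c (FpMul s t))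
  | fpEq_starD s t : fpEq (FpStar (FpAdd s t)) (FpAdd (FpStar s) (FpStar t))
  | fpEq_starZ c s :
      fpEq (FpStar (FpScale c s)) (FpScale (Num.conj c) (FpStar s))
  | fpEq_starM s t : fpEq (FpStar (FpMul s t)) (FpMul (FpStar t) (FpStar s))
  | fpEq_starK s : fpEq (FpStar (FpStar s)) s.

HB.instance Definition _ := gen_eqMixin fpTerm.
HB.instance Definition _ := gen_choiceMixin fpTerm.

Definition fpEqb (s t : fpTerm) : bool := `[< fpEq s t >].

Fact fpEqb_refl : reflexive fpEqb.
Proof. by move=> s; apply/asboolP; exact: fpEq_refl. Qed.
Fact fpEqb_sym : symmetric fpEqb.
Proof. by move=> s t; apply/asboolP/asboolP; exact: fpEq_sym. Qed.
Fact fpEqb_trans : transitive fpEqb.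
Proof.
move=> t s u /asboolP st /asboolP tu; apply/asboolP; exact: fpEq_trans tu.
Qed.
Canonical fpEqb_equiv := EquivRel fpEqb fpEqb_refl fpEqb_sym fpEqb_trans.

Definition freeProd := {eq_quot fpEqb_equiv}.
HB.instance Definition _ := Choice.on freeProd.
HB.instance Definition _ := EqQuotient.on freeProd.

Definition fpClass (s : fpTerm) : freeProd := \pi_freeProd s.

Lemma fpClassE s t : fpClass s = fpClass t <-> fpEq s t.
Proof. by split=> [/eqmodP/asboolP|st] //; apply/eqmodP/asboolP. Qed.

Lemma fpClassK x : fpClass (repr x) = x.
Proof. exact: reprK. Qed.

Lemma fpEq_repr s : fpEq (repr (fpClass s)) s.
Proof. by apply/fpClassE; rewrite fpClassK. Qed.

Lemma freeProdP (P : freeProd -> Prop) :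
  (forall s, P (fpClass s)) -> forall x, P x.
Proof. by move=> Ps x; rewrite -(fpClassK x); apply: Ps. Qed.

Let zero := fpClass FpZero.
Let add (x y : freeProd) : freeProd := fpClass (FpAdd (repr x) (repr y)).
Let scale (c : R[i]) (x : freeProd) : freeProd := fpClass (FpScale c (repr x)).
Let opp (x : freeProd) := scale (-1) x.
Let mul (x y : freeProd) : freeProd := fpClass (FpMul (repr x) (repr y)).
Let st (x : freeProd) : freeProd := fpClass (FpStar (repr x)).

Let addE s t : add (fpClass s) (fpClass t) = fpClass (FpAdd s t).
Proof. by apply/fpClassE/fpEq_add; apply: fpEq_repr. Qed.
Let scaleE c s : scale c (fpClass s) = fpClass (FpScale c s).
Proof. by apply/fpClassE/fpEq_scale; apply: fpEq_repr. Qed.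
Let mulE s t : mul (fpClass s) (fpClass t) = fpClass (FpMul s t).
Proof. by apply/fpClassE/fpEq_mul; apply: fpEq_repr. Qed.
Let stE s : st (fpClass s) = fpClass (FpStar s).
Proof. by apply/fpClassE/fpEq_star; apply: fpEq_repr. Qed.
Let opE := (addE, scaleE, mulE, stE).

Fact freeProd_addA : associative add.
Proof.
elim/freeProdP=> s; elim/freeProdP=> t; elim/freeProdP=> u.
by rewrite !opE; apply/fpClassE; constructor.
Qed.
Fact freeProd_addC : commutative add.
Proof.
by elim/freeProdP=> s; elim/freeProdP=> t; rewrite !opE; apply/fpClassE; exact: fpEq_addC.
Qed.
Fact freeProd_add0 : left_id zero add.
Proof. by elim/freeProdP=> s; rewrite !opE; apply/fpClassE; exact: fpEq_add0. Qed.
Fact freeProd_addN : left_inverse zero opp add.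
Proof.
by elim/freeProdP=> s; rewrite /opp !opE; apply/fpClassE; exact: fpEq_addN.
Qed.
HB.instance Definition _ := GRing.isZmodule.Build freeProd
  freeProd_addA freeProd_addC freeProd_add0 freeProd_addN.

Fact freeProd_scaleA c d x : scale c (scale d x) = scale (c * d) x.
Proof.
by elim/freeProdP: x => s; rewrite !opE; apply/fpClassE; exact: fpEq_scaleA.
Qed.
Fact freeProd_scale1 : left_id 1 scale.
Proof. by elim/freeProdP=> s; rewrite !opE; apply/fpClassE; exact: fpEq_scale1. Qed.
Fact freeProd_scaleDr : right_distributive scale +%R.
Proof.
move=> c; elim/freeProdP=> s; elim/freeProdP=> t.
by rewrite /GRing.add/= !opE; apply/fpClassE; exact: fpEq_scaleDr.
Qed.
Fact freeProd_scaleDl x : {morph scale^~ x : c d / c + d}.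
Proof.
move=> c d; elim/freeProdP: x => s.
by rewrite [RHS]/GRing.add/= !opE; apply/fpClassE; exact: fpEq_scaleDl.
Qed.
HB.instance Definition _ := GRing.Zmodule_isLmodule.Build R[i] freeProd
  freeProd_scaleA freeProd_scale1 freeProd_scaleDr freeProd_scaleDl.

Lemma fpClass0 : fpClass FpZero = 0. Proof. by []. Qed.
Lemma fpClassD s t : fpClass (FpAdd s t) = fpClass s + fpClass t.
Proof. by rewrite -addE. Qed.
Lemma fpClassZ c s : fpClass (FpScale c s) = c *: fpClass s.
Proof. by rewrite -scaleE. Qed.

Fact freeProd_mulA : associative mul.
Proof.
elim/freeProdP=> s; elim/freeProdP=> t; elim/freeProdP=> u.
by rewrite !opE; apply/fpClassE; exact: fpEq_mulA.
Qed.
Fact freeProd_mulDl : left_distributive mul +%R.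
Proof.
elim/freeProdP=> s; elim/freeProdP=> t; elim/freeProdP=> u.
by rewrite -(fpClassD s t) !mulE -fpClassD; apply/fpClassE; exact: fpEq_mulDl.
Qed.
Fact freeProd_mulDr : right_distributive mul +%R.
Proof.
elim/freeProdP=> s; elim/freeProdP=> t; elim/freeProdP=> u.
by rewrite -(fpClassD t u) !mulE -fpClassD; apply/fpClassE; exact: fpEq_mulDr.
Qed.
Fact freeProd_mulZl (c : R[i]) (x y : freeProd) : mul (c *: x) y = c *: mul x y.
Proof.
elim/freeProdP: x => s; elim/freeProdP: y => t.
by rewrite -(fpClassZ c s) !mulE -fpClassZ; apply/fpClassE; exact: fpEq_mulZl.
Qed.
Fact freeProd_mulZr (c : R[i]) (x y : freeProd) : mul x (c *: y) = c *: mul x y.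
Proof.
elim/freeProdP: x => s; elim/freeProdP: y => t.
by rewrite -(fpClassZ c t) !mulE -fpClassZ; apply/fpClassE; exact: fpEq_mulZr.
Qed.
Fact freeProd_starD : {morph st : x y / x + y}.
Proof.
elim/freeProdP=> s; elim/freeProdP=> t.
by rewrite -(fpClassD s t) !stE -fpClassD; apply/fpClassE; exact: fpEq_starD.
Qed.
Fact freeProd_starZ (c : R[i]) (x : freeProd) : st (c *: x) = Num.conj c *: st x.
Proof.
elim/freeProdP: x => s.
by rewrite -(fpClassZ c s) !stE -fpClassZ; apply/fpClassE; exact: fpEq_starZ.
Qed.
Fact freeProd_starM x y : st (mul x y) = mul (st y) (st x).
Proof.
elim/freeProdP: x => s; elim/freeProdP: y => t.
by rewrite !opE; apply/fpClassE; exact: fpEq_starM.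
Qed.
Fact freeProd_starK : involutive st.
Proof. by elim/freeProdP=> s; rewrite !opE; apply/fpClassE; exact: fpEq_starK. Qed.
HB.instance Definition _ := Lmodule_isStarAlg.Build R freeProd
  freeProd_mulA freeProd_mulDl freeProd_mulDr freeProd_mulZl freeProd_mulZr
  freeProd_starD freeProd_starZ freeProd_starM freeProd_starK.

Lemma fpClassM s t : fpClass (FpMul s t) = smul (fpClass s) (fpClass t).
Proof. by rewrite -mulE. Qed.
Lemma fpClassS s : fpClass (FpStar s) = star (fpClass s).
Proof. by rewrite -stE. Qed.

Section Inclusion.
Variable i : I.
Definition freeProd_gen (a : A i) : freeProd := fpClass (FpGen a).
Fact freeProd_gen_linear : linear freeProd_gen.
Proof.
move=> c a b; rewrite /freeProd_gen -fpClassZ -fpClassD; apply/fpClassE.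
apply: fpEq_trans (fpEq_genD _ _) _.
by apply: fpEq_add; [exact: fpEq_genZ | exact: fpEq_refl].
Qed.
HB.instance Definition _ := GRing.isLinear.Build R[i] (A i) freeProd *:%R
  freeProd_gen freeProd_gen_linear.
Fact freeProd_genM : {morph freeProd_gen : x y / smul x y}.
Proof. by move=> x y; rewrite -fpClassM; apply/fpClassE; exact: fpEq_genM. Qed.
Fact freeProd_genS : {morph freeProd_gen : x / star x}.
Proof. by move=> x; rewrite -fpClassS; apply/fpClassE; exact: fpEq_genS. Qed.
Definition freeProd_in : starHom (A i) freeProd :=
  @StarHom R (A i) freeProd freeProd_gen freeProd_genM freeProd_genS.
End Inclusion.

Section Lift.
Variables (B : starAlgType R) (f : forall i, starHom (A i) B).

Fixpoint fpEval (s : fpTerm) : B :=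
  match s with
  | FpGen i a => f i a
  | FpZero => 0
  | FpAdd s t => fpEval s + fpEval t
  | FpScale c s => c *: fpEval s
  | FpMul s t => smul (fpEval s) (fpEval t)
  | FpStar s => star (fpEval s)
  end.

Lemma fpEval_eq s t : fpEq s t -> fpEval s = fpEval t.
Proof.
elim=> //=.
- by move=> ? ? ? _ -> _ ->.
- by move=> ? ? ? ? _ -> _ ->.
- by move=> ? ? ? _ ->.
- by move=> ? ? ? ? _ -> _ ->.
- by move=> ? ? _ ->.
- by move=> *; rewrite linearD.
- by move=> *; rewrite linearZ.
- by move=> *; rewrite starHomM.
- by move=> *; rewrite starHomS.
- by move=> *; rewrite addrA.
- by move=> *; rewrite addrC.
- by move=> *; rewrite add0r.
- by move=> *; rewrite scaleN1r addNr.
- by move=> *; rewrite scalerA.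
- by move=> *; rewrite scale1r.
- by move=> *; rewrite scalerDr.
- by move=> *; rewrite scalerDl.
- by move=> *; rewrite smulA.
- by move=> *; rewrite smulDl.
- by move=> *; rewrite smulDr.
- by move=> *; rewrite smulZl.
- by move=> *; rewrite smulZr.
- by move=> *; rewrite starD.
- by move=> *; rewrite starZ.
- by move=> *; rewrite starM.
- by move=> *; rewrite starK.
Qed.

Definition freeProd_eval (x : freeProd) : B := fpEval (repr x).

Lemma freeProd_evalE s : freeProd_eval (fpClass s) = fpEval s.
Proof. exact/fpEval_eq/fpEq_repr. Qed.

Fact freeProd_eval_linear : linear freeProd_eval.
Proof.
move=> c; elim/freeProdP=> s; elim/freeProdP=> t.
by rewrite -fpClassZ -fpClassD !freeProd_evalE.
Qed.
HB.instance Definition _ := GRing.isLinear.Build R[i] freeProd B *:%R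
  freeProd_eval freeProd_eval_linear.
Fact freeProd_evalM : {morph freeProd_eval : x y / smul x y}.
Proof.
elim/freeProdP=> s; elim/freeProdP=> t.
by rewrite -fpClassM !freeProd_evalE.
Qed.
Fact freeProd_evalS : {morph freeProd_eval : x / star x}.
Proof. by elim/freeProdP=> s; rewrite -fpClassS !freeProd_evalE. Qed.

Definition freeProd_lift : starHom freeProd B :=
  @StarHom R freeProd B freeProd_eval freeProd_evalM freeProd_evalS.

Lemma freeProd_lift_in i (a : A i) : freeProd_lift (freeProd_in i a) = f i a.
Proof. exact: freeProd_evalE. Qed.
End Lift.

Lemma freeProd_hom_ext (B : starAlgType R) (f g : starHom freeProd B) :
  (forall i (a : A i), f (freeProd_in i a) = g (freeProd_in i a)) -> f =1 g.
Proof.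
move=> fg; elim/freeProdP; elim.
- by move=> i a; exact: fg.
- by rewrite fpClass0 !linear0.
- by move=> s IHs t IHt; rewrite fpClassD !linearD IHs IHt.
- by move=> c s IHs; rewrite fpClassZ !linearZ IHs.
- by move=> s IHs t IHt; rewrite fpClassM !starHomM IHs IHt.
- by move=> s IHs; rewrite fpClassS !starHomS IHs.
Qed.

End FreeProduct.

Section BinaryFreeProduct.
Variable R : realType.

Definition pairFam (A1 A2 : starAlgType R) (b : bool) : starAlgType R :=
  if b then A1 else A2.

Definition freeProd2 (A1 A2 : starAlgType R) : starAlgType R :=
  freeProd (pairFam A1 A2).

Definition fp_in1 (A1 A2 : starAlgType R) : starHom A1 (freeProd2 A1 A2) :=
  freeProd_in (pairFam A1 A2) true.
Definition fp_in2 (A1 A2 : starAlgType R) : starHom A2 (freeProd2 A1 A2) :=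
  freeProd_in (pairFam A1 A2) false.

Definition fp_case (A1 A2 B : starAlgType R)
    (f1 : starHom A1 B) (f2 : starHom A2 B) : starHom (freeProd2 A1 A2) B :=
  freeProd_lift (fun b : bool =>
    match b return starHom (pairFam A1 A2 b) B with
    | true => f1 | false => f2 end).

Definition fp_map (A1 A2 B1 B2 : starAlgType R)
    (j1 : starHom B1 A1) (j2 : starHom B2 A2) :
    starHom (freeProd2 B1 B2) (freeProd2 A1 A2) :=
  fp_case (starHom_comp (fp_in1 A1 A2) j1) (starHom_comp (fp_in2 A1 A2) j2).

(* The canonical identification; it is bijective by fp_assoc_bij.             *)
Definition fp_assoc (A1 A2 A3 : starAlgType R) :
    starHom (freeProd2 (freeProd2 A1 A2) A3) (freeProd2 A1 (freeProd2 A2 A3)) :=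
  fp_case
    (fp_case (fp_in1 A1 (freeProd2 A2 A3))
       (starHom_comp (fp_in2 A1 (freeProd2 A2 A3)) (fp_in1 A2 A3)))
    (starHom_comp (fp_in2 A1 (freeProd2 A2 A3)) (fp_in2 A2 A3)).

Section Theory.
Variables A1 A2 B : starAlgType R.

Lemma fp_case1 (f1 : starHom A1 B) (f2 : starHom A2 B) a :
  fp_case f1 f2 (fp_in1 A1 A2 a) = f1 a.
Proof. exact: (freeProd_lift_in (A := pairFam A1 A2)). Qed.

Lemma fp_case2 (f1 : starHom A1 B) (f2 : starHom A2 B) a :
  fp_case f1 f2 (fp_in2 A1 A2 a) = f2 a.
Proof. exact: (freeProd_lift_in (A := pairFam A1 A2)). Qed.

Lemma fp_hom_ext (f g : starHom (freeProd2 A1 A2) B) :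
  (forall a, f (fp_in1 A1 A2 a) = g (fp_in1 A1 A2 a)) ->
  (forall a, f (fp_in2 A1 A2 a) = g (fp_in2 A1 A2 a)) -> f =1 g.
Proof. by move=> fg1 fg2; apply: freeProd_hom_ext => -[]. Qed.
End Theory.

Lemma fp_assoc_bij A1 A2 A3 : bijective (fp_assoc A1 A2 A3).
Proof.
pose g := fp_case
    (starHom_comp (fp_in1 (freeProd2 A1 A2) A3) (fp_in1 A1 A2))
    (fp_case (starHom_comp (fp_in1 (freeProd2 A1 A2) A3) (fp_in2 A1 A2))
       (fp_in2 (freeProd2 A1 A2) A3)).
exists g => x.
- apply: (fp_hom_ext (f := starHom_comp g (fp_assoc A1 A2 A3))
    (g := starHom_id _)) => {x} [x|a] /=; last first.
    by rewrite fp_case2 /= fp_case2 fp_case2.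
  rewrite fp_case1.
  apply: (fp_hom_ext
    (f := starHom_comp g (fp_case (fp_in1 A1 (freeProd2 A2 A3))
       (starHom_comp (fp_in2 A1 (freeProd2 A2 A3)) (fp_in1 A2 A3))))
    (g := fp_in1 (freeProd2 A1 A2) A3)) => {x} a /=.
    by rewrite fp_case1 fp_case1.
  by rewrite fp_case2 /= fp_case2 fp_case1.
- apply: (fp_hom_ext (f := starHom_comp (fp_assoc A1 A2 A3) g)
    (g := starHom_id _)) => {x} [a|x] /=.
    by rewrite fp_case1 /= fp_case1 fp_case1.
  rewrite fp_case2.
  apply: (fp_hom_ext
    (f := starHom_comp (fp_assoc A1 A2 A3)
       (fp_case (starHom_comp (fp_in1 (freeProd2 A1 A2) A3) (fp_in2 A1 A2))
       (fp_in2 (freeProd2 A1 A2) A3)))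
    (g := fp_in2 A1 (freeProd2 A2 A3))) => {x} a /=.
    by rewrite fp_case1 /= fp_case1 fp_case2.
  by rewrite fp_case2 /= fp_case2.
Qed.

End BinaryFreeProduct.

Section StarHomMore.
Variable R : realType.

Section Zero.
Variables A B : starAlgType R.
Fact starHom_zeroM : {morph (\0 : A -> B) : x y / smul x y}.
Proof. by move=> x y; rewrite /= -[X in smul X _](scale0r (0 : B)) smulZl scale0r. Qed.
Fact starHom_zeroS : {morph (\0 : A -> B) : x / star x}.
Proof. by move=> x; rewrite /= -[X in star X](scale0r (0 : B)) starZ conjC0 scale0r. Qed.
Definition starHom_zero : starHom A B :=
  @StarHom R A B (\0 : A -> B) starHom_zeroM starHom_zeroS.
End Zero.

Lemma starHom_inv (A B : starAlgType R) (f : starHom A B) (g : B -> A) :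
  cancel f g -> cancel g f -> exists h : starHom B A, h =1 g.
Proof.
move=> fK gK.
have gL : linear g.
  by move=> c x y; apply: (can_inj fK); rewrite linearP !gK.
have gM : {morph g : x y / smul x y}.
  by move=> x y; apply: (can_inj fK); rewrite starHomM !gK.
have gS : {morph g : x / star x}.
  by move=> x; apply: (can_inj fK); rewrite starHomS !gK.
pose gLin := GRing.isLinear.Build R[i] B A *:%R g gL.
pose gl : {linear B -> A} := HB.pack g gLin.
by exists (@StarHom R B A gl gM gS).
Qed.

Section Corestriction.
Variables (A B : starAlgType R) (S : subStarAlg B) (f : starHom A B).
Hypothesis fS : forall x, subset_of S (f x).

Definition corestr (x : A) : subAlg S := SubAlg (introT (asboolP _) (fS x)).
Fact corestr_linear : linear corestr.
Proof. by move=> c x y; apply: val_inj; rewrite /= linearP. Qed.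
HB.instance Definition _ := GRing.isLinear.Build R[i] A (subAlg S) *:%R
  corestr corestr_linear.
Fact corestrM : {morph corestr : x y / smul x y}.
Proof. by move=> x y; apply: val_inj; rewrite /= starHomM. Qed.
Fact corestrS : {morph corestr : x / star x}.
Proof. by move=> x; apply: val_inj; rewrite /= starHomS. Qed.
Definition starHom_corestr : starHom A (subAlg S) :=
  @StarHom R A (subAlg S) corestr corestrM corestrS.
End Corestriction.

End StarHomMore.

Record mFaced (R : realType) (m : nat) := MFaced {
  mf_alg :> starAlgType R;
  face : 'I_m -> subStarAlg mf_alg;
  face_free : bijective (freeProd_lift (fun k => subAlg_incl (face k)))
}.

Section MFacedTheory.
Variables (R : realType) (m : nat).

Section Universal.
Variables (A : mFaced R m) (B : starAlgType R).

Lemma mf_hom_ext (f g : starHom A B) :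
  (forall k x, subset_of (face A k) x -> f x = g x) -> f =1 g.
Proof.
move=> fg x; have [c cK Kc] := face_free A; rewrite -(Kc x).
set can := freeProd_lift _.
apply: (freeProd_hom_ext (f := starHom_comp f can) (g := starHom_comp g can)).
by move=> k a /=; rewrite freeProd_lift_in; apply: fg (subAlgP a).
Qed.

Lemma mf_lift (f : forall k, starHom (subAlg (face A k)) B) :
  exists h : starHom A B, forall k (x : subAlg (face A k)), h (val x) = f k x.
Proof.
have [c cK Kc] := face_free A; have [h hc] := starHom_inv cK Kc.
exists (starHom_comp (freeProd_lift f) h) => k x /=.
rewrite hc -(freeProd_lift_in f); congr (freeProd_lift f _).
by rewrite -[RHS]cK freeProd_lift_in.
Qed.
End Universal.

Section FreeProduct.
Variables A1 A2 : mFaced R m.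

Definition face_map (k : 'I_m) :
    starHom (freeProd2 (subAlg (face A1 k)) (subAlg (face A2 k)))
            (freeProd2 A1 A2) :=
  fp_map (subAlg_incl (face A1 k)) (subAlg_incl (face A2 k)).

Definition fp_face (k : 'I_m) : subStarAlg (freeProd2 A1 A2) :=
  starHom_image (face_map k).

Lemma fp_face_free :
  bijective (freeProd_lift (fun k => subAlg_incl (fp_face k))).
Proof.
set can := freeProd_lift _.
have in1P k (x : subAlg (face A1 k)) :
    subset_of (fp_face k) (starHom_comp (fp_in1 A1 A2) (subAlg_incl _) x).
  by exists (fp_in1 _ _ x); rewrite fp_case1.
have in2P k (x : subAlg (face A2 k)) :
    subset_of (fp_face k) (starHom_comp (fp_in2 A1 A2) (subAlg_incl _) x).
  by exists (fp_in2 _ _ x); rewrite fp_case2.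
pose gen k := freeProd_in (fun k => subAlg (fp_face k) : starAlgType R) k.
have [h1 h1E] := mf_lift (fun k =>
  starHom_comp (gen k) (starHom_corestr (in1P k))).
have [h2 h2E] := mf_lift (fun k =>
  starHom_comp (gen k) (starHom_corestr (in2P k))).
pose inv := fp_case h1 h2.
have canE k x : can (gen k x) = val x by exact: freeProd_lift_in.
exists inv => x.
- apply: (freeProd_hom_ext (f := starHom_comp inv can)
    (g := starHom_id _)) => {x} k [x xP] /=.
  rewrite [can _]canE /=.
  have /asboolP [y yx] := xP; case: _ / yx in xP *.
  have yP z : subset_of (fp_face k) (face_map k z) by exists z.
  rewrite -[RHS]/(gen k (SubAlg xP)).
  have -> : SubAlg xP = starHom_corestr yP y by exact: val_inj.
  apply: (fp_hom_ext (f := starHom_comp inv (face_map k))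
    (g := starHom_comp (gen k) (starHom_corestr yP))) => {xP} {}y /=.
  + rewrite fp_case1 /= /inv fp_case1 h1E /=; congr (gen k _).
    by apply: val_inj; rewrite /= fp_case1.
  + rewrite fp_case2 /= /inv fp_case2 h2E /=; congr (gen k _).
    by apply: val_inj; rewrite /= fp_case2.
- apply: (fp_hom_ext (f := starHom_comp can inv) (g := starHom_id _)) => {}x /=.
  + rewrite /inv fp_case1.
    apply: (mf_hom_ext (f := starHom_comp can h1) (g := fp_in1 A1 A2)) => k {}x xP.
    by rewrite /= (h1E k (SubAlg (introT (asboolP _) xP))) /= [can _]canE.
  + rewrite /inv fp_case2.
    apply: (mf_hom_ext (f := starHom_comp can h2) (g := fp_in2 A1 A2)) => k {}x xP.
    by rewrite /= (h2E k (SubAlg (introT (asboolP _) xP))) /= [can _]canE.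
Qed.

(* The face k is the image of the canonical map from the free product of the  *)
(* faces k of A1 and A2; it is injective by face_map_inj.                     *)
Definition mfProd : mFaced R m := MFaced fp_face_free.

End FreeProduct.

Lemma face_retract (A : mFaced R m) (k : 'I_m) :
  exists r : starHom A (subAlg (face A k)), forall x, r (val x) = x.
Proof.
pose f l : starHom (subAlg (face A l)) (subAlg (face A k)) :=
  match l =P k with
  | ReflectT e =>
      eq_rect l (fun l' => starHom (subAlg (face A l)) (subAlg (face A l')))
        (starHom_id _) k e
  | ReflectF _ => starHom_zero _ _
  end.
have [r rE] := mf_lift f; exists r => x; rewrite rE /f.
by case: eqP => // e; rewrite (eq_axiomK e).
Qed.

Lemma face_map_inj (A1 A2 : mFaced R m) k : injective (face_map A1 A2 k).
Proof.
have [r1 r1E] := face_retract A1 k; have [r2 r2E] := face_retract A2 k.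
apply: (@can_inj _ _ _ (fp_map r1 r2)) => x.
apply: (fp_hom_ext (f := starHom_comp (fp_map r1 r2) (face_map A1 A2 k))
  (g := starHom_id _)) => {}x /=.
- by rewrite fp_case1 /= fp_case1 /= r1E.
- by rewrite fp_case2 /= fp_case2 /= r2E.
Qed.

Record mfHom (B A : mFaced R m) := MFHom {
  mfHom_hom :> starHom B A;
  mfHom_face : forall k x, subset_of (face B k) x -> subset_of (face A k) (mfHom_hom x)
}.

End MFacedTheory.

Section Unitization.
Variables (R : realType) (A : starAlgType R).

Definition unitization : Type := (R[i]^o * A)%type.
HB.instance Definition _ := GRing.Lmodule.on unitization.

Implicit Types x y : unitization.

Let mul x y : unitization :=
  (x.1 * y.1, x.1 *: y.2 + y.1 *: x.2 + smul x.2 y.2).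
Let st x : unitization := (Num.conj (x.1 : R[i]), star x.2).

Fact unitization_mulA : associative mul.
Proof.
move=> [a x] [b y] [c z]; congr pair; rewrite /= ?mulrA //.
rewrite !(scalerDr, smulDl, smulDr, smulZl, smulZr) !scalerA smulA !addrA.
by rewrite [c * a]mulrC [c * b]mulrC [LHS](ACl (1*2*4*6*3*5*7)).
Qed.
Fact unitization_mulDl : left_distributive mul +%R.
Proof.
move=> [a x] [b y] [c z]; congr pair; rewrite /= ?mulrDl //.
by rewrite scalerDl scalerDr smulDl !addrA [LHS](ACl (1*3*5*2*4*6)).
Qed.
Fact unitization_mulDr : right_distributive mul +%R.
Proof.
move=> [a x] [b y] [c z]; congr pair; rewrite /= ?mulrDr //.
by rewrite scalerDl scalerDr smulDr !addrA [LHS](ACl (1*3*5*2*4*6)).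
Qed.
Fact unitization_mulZl (c : R[i]) x y : mul (c *: x) y = c *: mul x y.
Proof.
case: x y => [a x] [b y]; congr pair; first exact: (esym (mulrA c a b)).
by rewrite /= smulZl -[c *: a]/(c * a) !scalerDr !scalerA [b * c]mulrC.
Qed.
Fact unitization_mulZr (c : R[i]) x y : mul x (c *: y) = c *: mul x y.
Proof.
case: x y => [a x] [b y]; congr pair; first exact: (mulrCA a c b).
by rewrite /= smulZr -[c *: b]/(c * b) !scalerDr !scalerA [a * c]mulrC.
Qed.
Fact unitization_starD : {morph st : x y / x + y}.
Proof. by move=> [a x] [b y]; congr pair; rewrite /= ?rmorphD ?starD. Qed.
Fact unitization_starZ (c : R[i]) x : st (c *: x) = Num.conj c *: st x.
Proof.
by case: x => [a x]; congr pair; [exact: (rmorphM Num.conj c a) | exact: starZ].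
Qed.
Fact unitization_starM x y : st (mul x y) = mul (st y) (st x).
Proof.
case: x y => [a x] [b y]; congr pair; rewrite /= ?rmorphM 1?mulrC //.
by rewrite !starD !starZ starM [X in X + _]addrC.
Qed.
Fact unitization_starK : involutive st.
Proof. by move=> [a x]; congr pair; rewrite /= ?conjCK ?starK. Qed.
HB.instance Definition _ := Lmodule_isStarAlg.Build R unitization
  unitization_mulA unitization_mulDl unitization_mulDr
  unitization_mulZl unitization_mulZr
  unitization_starD unitization_starZ unitization_starM unitization_starK.

Definition unital_ext (phi : A -> R[i]) (x : unitization) : R[i] :=
  x.1 + phi x.2.

End Unitization.

Definition positive (R : realType) (A : starAlgType R) (phi : A -> R[i]) : Prop :=
  forall a, 0 <= phi (smul (star a) a).

Record state (R : realType) (A : starAlgType R) := State {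
  state_fun :> {scalar A};
  state_positive : positive (unital_ext state_fun)
}.

Section StateComp.
Variables (R : realType) (A B : starAlgType R).
Variables (phi : state A) (j : starHom B A).

Fact state_comp_positive : positive (unital_ext (phi \o j)).
Proof.
move=> [c b]; have := state_positive phi ((c, j b) : unitization A).
rewrite /unital_ext /=; congr (0 <= _ + phi _).
by rewrite !linearD !linearZ starHomM starHomS.
Qed.

Definition state_comp : state B :=
  @State R B (phi \o j : {scalar B}) state_comp_positive.
End StateComp.

Section AdjointableOperators.
Variables (R : realType) (H : preHilbType R).
Implicit Types x y : H.

Lemma innerDl x y z : inner (x + y) z = inner x z + inner y z.
Proof. by rewrite innerC innerDr rmorphD /= -(innerC z x) -(innerC z y). Qed.
Lemma innerZl (c : R[i]) x y : inner (c *: x) y = Num.conj c * inner x y.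
Proof. by rewrite innerC innerZr rmorphM /= -(innerC y x). Qed.
Lemma innerNr x y : inner x (- y) = - inner x y.
Proof. by rewrite -scaleN1r innerZr mulN1r. Qed.
Lemma inner0r x : inner x 0 = 0.
Proof. by rewrite -(scale0r (0 : H)) innerZr mul0r. Qed.
Lemma inner0l x : inner 0 x = 0.
Proof. by rewrite innerC inner0r conjC0. Qed.
Lemma inner_inj x y : (forall z, inner z x = inner z y) -> x = y.
Proof.
move=> xy; apply/eqP; rewrite -subr_eq0; apply/eqP/inner_eq0.
by rewrite innerDr innerNr xy subrr.
Qed.

Definition is_adjoint (f g : H -> H) : Prop :=
  forall x y, inner (g x) y = inner x (f y).

(* Linearity is implied by the existence of an adjoint; it is kept to match   *)
(* the usual definition.                                                      *)
Definition adjointable (f : H -> H) : Prop :=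
  linear f /\ exists g, is_adjoint f g.

Lemma is_adjoint_sym f g : is_adjoint f g -> is_adjoint g f.
Proof. by move=> fg x y; rewrite [LHS]innerC -fg -(innerC (g y) x). Qed.

Lemma is_adjoint_uniq f g g' : is_adjoint f g -> is_adjoint f g' -> g = g'.
Proof.
move=> fg fg'; apply/funext => x; apply: inner_inj => z.
by rewrite [LHS]innerC [RHS]innerC fg fg'.
Qed.

Lemma is_adjoint_linear f g : is_adjoint f g -> linear g.
Proof.
move=> /is_adjoint_sym gf c x y; apply: inner_inj => z.
by rewrite innerDr innerZr -!gf innerDr innerZr.
Qed.

Definition adjointable_pred : {pred (H -> H)} := fun f => `[< adjointable f >].

Fact adjointable_closed : submod_closed adjointable_pred.
Proof.
split.
  apply/asboolP; split=> [c x y|]; first by rewrite /= scaler0 addr0.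
  by exists (fun=> 0) => x y; rewrite inner0l inner0r.
move=> c f g /asboolP [fL [f' ff']] /asboolP [gL [g' gg']].
apply/asboolP; split.
  move=> d x y; rewrite !fctE fL gL !scalerDr !scalerA [c * d]mulrC !addrA.
  by rewrite [LHS](ACl (1*3*2*4)).
exists (fun x => Num.conj c *: f' x + g' x) => x y.
by rewrite innerDl innerZl conjCK ff' gg' !fctE innerDr innerZr.
Qed.
HB.instance Definition _ := GRing.isSubmodClosed.Build R[i] (H -> H)
  adjointable_pred adjointable_closed.

Record adjOp := AdjOp {
  adjOp_fun :> H -> H;
  adjOp_in : adjOp_fun \in adjointable_pred
}.
HB.instance Definition _ := [isSub for adjOp_fun].
HB.instance Definition _ := [Choice of adjOp by <:].
HB.instance Definition _ := [SubChoice_isSubLmodule of adjOp by <:].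

Implicit Types S T : adjOp.

Lemma adjOpP T : adjointable T.
Proof. by case: T => f /= /asboolP. Qed.

Definition adj_fun T : H -> H := projT1 (cid (adjOpP T).2).

Lemma adj_funP T : is_adjoint T (adj_fun T).
Proof. exact: projT2 (cid (adjOpP T).2). Qed.

Fact adj_fun_in T : adj_fun T \in adjointable_pred.
Proof.
apply/asboolP; split; first exact: is_adjoint_linear (@adj_funP T).
by exists T; apply: is_adjoint_sym; exact: adj_funP.
Qed.

Lemma is_adjoint_comp f g f' g' : is_adjoint f f' -> is_adjoint g g' ->
  is_adjoint (f \o g) (g' \o f').
Proof. by move=> ff' gg' x y; rewrite /= gg' ff'. Qed.

Fact comp_in S T : (S : H -> H) \o T \in adjointable_pred.
Proof.
apply/asboolP; split.
  by move=> c x y; rewrite /= (adjOpP T).1 (adjOpP S).1.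
by exists (adj_fun T \o adj_fun S); apply: is_adjoint_comp; exact: adj_funP.
Qed.

Let mul S T := AdjOp (comp_in S T).
Let st T := AdjOp (adj_fun_in T).

Lemma st_eq T g : is_adjoint T g -> st T = g :> (H -> H).
Proof. exact: is_adjoint_uniq (@adj_funP T). Qed.

Fact adjOp_mulA : associative mul.
Proof. by move=> S T U; apply: val_inj. Qed.
Fact adjOp_mulDl : left_distributive mul +%R.
Proof. by move=> S T U; apply: val_inj. Qed.
Fact adjOp_mulDr : right_distributive mul +%R.
Proof.
move=> S T U; apply: val_inj; apply/funext => x /=.
by have := (adjOpP S).1 1 (T x) (U x); rewrite !scale1r; exact.
Qed.
Fact adjOp_mulZl (c : R[i]) S T : mul (c *: S) T = c *: mul S T.
Proof. by apply: val_inj. Qed.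
Fact adjOp_mulZr (c : R[i]) S T : mul S (c *: T) = c *: mul S T.
Proof.
apply: val_inj; apply/funext => x /=; rewrite !fctE /=.
have S0 : S 0 = 0.
  by have := (adjOpP S).1 (-1) 0 0; rewrite scaler0 addr0 scaleN1r addNr.
by rewrite -[c *: T x]addr0 (adjOpP S).1 S0 addr0.
Qed.
Fact adjOp_starD : {morph st : S T / S + T}.
Proof.
move=> S T; apply: val_inj; apply: st_eq => x y.
by rewrite /= !fctE innerDl innerDr !adj_funP.
Qed.
Fact adjOp_starZ (c : R[i]) T : st (c *: T) = Num.conj c *: st T.
Proof.
apply: val_inj; apply: st_eq => x y.
by rewrite /= !fctE innerZl conjCK innerZr adj_funP.
Qed.
Fact adjOp_starM S T : st (mul S T) = mul (st T) (st S).
Proof.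
by apply: val_inj; apply: st_eq; apply: is_adjoint_comp; exact: adj_funP.
Qed.
Fact adjOp_starK : involutive st.
Proof.
move=> T; apply: val_inj; apply: st_eq; apply: is_adjoint_sym.
exact: adj_funP.
Qed.
HB.instance Definition _ := Lmodule_isStarAlg.Build R adjOp
  adjOp_mulA adjOp_mulDl adjOp_mulDr adjOp_mulZl adjOp_mulZr
  adjOp_starD adjOp_starZ adjOp_starM adjOp_starK.

Lemma smul_adjOpE S T x : smul S T x = S (T x).
Proof. by []. Qed.

Lemma inner_star T x y : inner (star T x) y = inner x (T y).
Proof. exact: adj_funP. Qed.

End AdjointableOperators.

Notation starRep A H := (starHom A (adjOp H)).

Record arrow (R : realType) (H G : preHilbType R) := Arrow {
  arrow_fun :> {linear H -> G};
  arrow_inner : forall x y, inner (arrow_fun x) (arrow_fun y) = inner x y;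
  arrow_Omega : arrow_fun Omega = Omega
}.

Section ArrowTheory.
Variable R : realType.

Lemma arrow_ext (H G : preHilbType R) (V W : arrow H G) : V =1 W -> V = W.
Proof.
case: V W => [[V [[v1] [v2]]] Vi VO] [[W [[w1] [w2]]] Wi WO] /= /funext VW.
subst W; have e1 := Prop_irrelevance v1 w1; have e2 := Prop_irrelevance v2 w2.
by subst w1 w2; congr Arrow; exact: Prop_irrelevance.
Qed.

Definition arrow_id (H : preHilbType R) : arrow H H :=
  @Arrow R H H idfun (fun _ _ => erefl) erefl.

Section Comp.
Variables (H1 H2 H3 : preHilbType R) (V : arrow H2 H3) (W : arrow H1 H2).
Fact arrow_comp_inner x y : inner ((V \o W) x) ((V \o W) y) = inner x y.
Proof. by rewrite /= !arrow_inner. Qed.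
Fact arrow_comp_Omega : (V \o W) Omega = Omega.
Proof. by rewrite /= !arrow_Omega. Qed.
Definition arrow_comp : arrow H1 H3 :=
  @Arrow R H1 H3 (V \o W) arrow_comp_inner arrow_comp_Omega.
End Comp.

Record arrow_iso (H G : preHilbType R) := ArrowIso {
  iso_fwd :> arrow H G;
  iso_inv : arrow G H;
  iso_fwdK : cancel iso_fwd iso_inv;
  iso_invK : cancel iso_inv iso_fwd
}.

End ArrowTheory.

(* Monoidal structures on the category of pre-Hilbert spaces and Omega-       *)
(* preserving isometries, with an initial object as unit. Associativity and   *)
(* unitality are not strict, so the identifications made along them are       *)
(* expressed with assoc, lunit and runit.                                     *)
Record monProd (R : realType) := MonProd {
  tens : preHilbType R -> preHilbType R -> preHilbType R;
  tensA : forall H1 H2 G1 G2,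
    arrow H1 G1 -> arrow H2 G2 -> arrow (tens H1 H2) (tens G1 G2);
  tensA_id : forall H1 H2,
    tensA (arrow_id H1) (arrow_id H2) = arrow_id (tens H1 H2);
  tensA_comp : forall H1 H2 G1 G2 K1 K2
      (V1 : arrow G1 K1) (V2 : arrow G2 K2) (W1 : arrow H1 G1) (W2 : arrow H2 G2),
    tensA (arrow_comp V1 W1) (arrow_comp V2 W2) =
    arrow_comp (tensA V1 V2) (tensA W1 W2);

  munit : preHilbType R;
  munit_arrow : forall H, arrow munit H;
  munit_initial : forall H (W : arrow munit H), W = munit_arrow H;

  assoc : forall H1 H2 H3,
    arrow_iso (tens (tens H1 H2) H3) (tens H1 (tens H2 H3));
  assoc_natural : forall H1 H2 H3 G1 G2 G3
      (W1 : arrow H1 G1) (W2 : arrow H2 G2) (W3 : arrow H3 G3),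
    arrow_comp (assoc G1 G2 G3) (tensA (tensA W1 W2) W3) =
    arrow_comp (tensA W1 (tensA W2 W3)) (assoc H1 H2 H3);
  lunit : forall H, arrow_iso (tens munit H) H;
  lunit_natural : forall H G (W : arrow H G),
    arrow_comp (lunit G) (tensA (arrow_id munit) W) = arrow_comp W (lunit H);
  runit : forall H, arrow_iso (tens H munit) H;
  runit_natural : forall H G (W : arrow H G),
    arrow_comp (runit G) (tensA W (arrow_id munit)) = arrow_comp W (runit H);
  pentagon : forall H1 H2 H3 H4,
    arrow_comp (assoc H1 H2 (tens H3 H4)) (assoc (tens H1 H2) H3 H4) =
    arrow_comp (tensA (arrow_id H1) (assoc H2 H3 H4))
      (arrow_comp (assoc H1 (tens H2 H3) H4)
         (tensA (assoc H1 H2 H3) (arrow_id H4)));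
  triangle : forall H1 H2,
    arrow_comp (tensA (arrow_id H1) (lunit H2)) (assoc H1 munit H2) =
    tensA (runit H1) (arrow_id H2)
}.

Section UniversalProducts.
Variables (R : realType) (m : nat).

Section Embeddings.
Variables (T : monProd R) (H1 H2 : preHilbType R).

(* The canonical inclusions of H1 and H2 into their product.                  *)
Definition emb1 : arrow H1 (tens T H1 H2) :=
  arrow_comp (tensA T (arrow_id H1) (munit_arrow T H2)) (iso_inv (runit T H1)).

Definition emb2 : arrow H2 (tens T H1 H2) :=
  arrow_comp (tensA T (munit_arrow T H1) (arrow_id H2)) (iso_inv (lunit T H2)).

End Embeddings.

Definition stateOp : Type := forall A1 A2 : mFaced R m,
  state A1 -> state A2 -> state (mfProd A1 A2).

Record universal_state_product (odot : stateOp) : Prop := {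
  usp_assoc : forall (A1 A2 A3 : mFaced R m)
      (phi1 : state A1) (phi2 : state A2) (phi3 : state A3)
      (a : mfProd (mfProd A1 A2) A3),
    odot _ _ phi1 (odot _ _ phi2 phi3) (fp_assoc A1 A2 A3 a) =
    odot _ _ (odot _ _ phi1 phi2) phi3 a;
  usp_universal : forall (A1 A2 B1 B2 : mFaced R m)
      (j1 : mfHom B1 A1) (j2 : mfHom B2 A2) (phi1 : state A1) (phi2 : state A2)
      (b : mfProd B1 B2),
    odot B1 B2 (state_comp phi1 j1) (state_comp phi2 j2) b =
    odot _ _ phi1 phi2 (fp_map j1 j2 b);
  usp_restr1 : forall (A1 A2 : mFaced R m) (phi1 : state A1) (phi2 : state A2)
      (a : A1), odot _ _ phi1 phi2 (fp_in1 A1 A2 a) = phi1 a;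
  usp_restr2 : forall (A1 A2 : mFaced R m) (phi1 : state A1) (phi2 : state A2)
      (a : A2), odot _ _ phi1 phi2 (fp_in2 A1 A2 a) = phi2 a
}.

Definition repOp (T : monProd R) : Type :=
  forall (A1 A2 : mFaced R m) (H1 H2 : preHilbType R),
    starRep A1 H1 -> starRep A2 H2 -> starRep (mfProd A1 A2) (tens T H1 H2).

Record universal_rep_product (T : monProd R) (odot : repOp T) : Prop := {
  urp_assoc : forall (A1 A2 A3 : mFaced R m) (H1 H2 H3 : preHilbType R)
      (pi1 : starRep A1 H1) (pi2 : starRep A2 H2) (pi3 : starRep A3 H3)
      (a : mfProd (mfProd A1 A2) A3) (x : tens T (tens T H1 H2) H3),
    odot _ _ _ _ pi1 (odot _ _ _ _ pi2 pi3) (fp_assoc A1 A2 A3 a)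
      (assoc T H1 H2 H3 x) =
    assoc T H1 H2 H3 (odot _ _ _ _ (odot _ _ _ _ pi1 pi2) pi3 a x);
  urp_universal_alg : forall (A1 A2 B1 B2 : mFaced R m) (H1 H2 : preHilbType R)
      (j1 : mfHom B1 A1) (j2 : mfHom B2 A2)
      (pi1 : starRep A1 H1) (pi2 : starRep A2 H2) (b : mfProd B1 B2),
    odot _ _ _ _ pi1 pi2 (fp_map j1 j2 b) =
    odot B1 B2 _ _ (starHom_comp pi1 j1) (starHom_comp pi2 j2) b;
  urp_universal_hilb : forall (A1 A2 : mFaced R m)
      (H1 H2 G1 G2 : preHilbType R) (W1 : arrow H1 G1) (W2 : arrow H2 G2)
      (pi1 : starRep A1 H1) (pi2 : starRep A2 H2)
      (sigma1 : starRep A1 G1) (sigma2 : starRep A2 G2),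
    (forall a x, W1 (pi1 a x) = sigma1 a (W1 x)) ->
    (forall a x, W2 (pi2 a x) = sigma2 a (W2 x)) ->
    forall (a : mfProd A1 A2) x,
      tensA T W1 W2 (odot _ _ _ _ pi1 pi2 a x) =
      odot _ _ _ _ sigma1 sigma2 a (tensA T W1 W2 x);
  urp_restr1 : forall (A1 A2 : mFaced R m) (H1 H2 : preHilbType R)
      (pi1 : starRep A1 H1) (pi2 : starRep A2 H2) (a : A1) (x : H1),
    odot _ _ _ _ pi1 pi2 (fp_in1 A1 A2 a) (emb1 T H1 H2 x) =
    emb1 T H1 H2 (pi1 a x);
  urp_restr2 : forall (A1 A2 : mFaced R m) (H1 H2 : preHilbType R)
      (pi1 : starRep A1 H1) (pi2 : starRep A2 H2) (a : A2) (x : H2),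
    odot _ _ _ _ pi1 pi2 (fp_in2 A1 A2 a) (emb2 T H1 H2 x) =
    emb2 T H1 H2 (pi2 a x)
}.

End UniversalProducts.

(* Main.v *)
(* The GNS construction turns a state phi into a cyclic representation with   *)
(* vacuum state phi, and every representation on H with vacuum state phi      *)
(* receives an intertwining isometry from it, sending the class of c + a to   *)
(* c Omega + pi(a) Omega. By universality for pre-Hilbert spaces the vacuum   *)
(* state of a product of representations therefore depends only on the vacuum *)
(* states of the factors, so the product of states can be defined from the GNS *)
(* representations and its axioms checked on any convenient representations.  *)
Require Import Defs.
From mathcomp Require Import all_boot all_order all_algebra reals ring.
From HB Require Import structures.
From mathcomp Require Import boolp classical_sets functions.

Set Implicit Arguments.
Unset Strict Implicit.
Unset Printing Implicit Defensive.

Import Order.TTheory GRing.Theory Num.Theory.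
Local Open Scope ring_scope.

(** Any representation with vacuum state [phi] contains the GNS representation of [phi] as the
    invariant subspace generated by [Omega] ([gns_arrow]). The product of two such inclusions is an
    isometry fixing [Omega] that intertwines the product representations, so both give the same
    vacuum expectations ([state_odotE]). Each axiom for states then becomes the matching axiom for
    representations, evaluated at [Omega]; associators and embeddings are harmless there, being
    isometries that fix [Omega]. *)

Section StarAlgZero.
Variables (R : realType) (A : starAlgType R).

Lemma star0 : star (0 : A) = 0.
Proof. by rewrite -(scale0r (0 : A)) starZ conjC0 !scale0r. Qed.

Lemma smul0r (x : A) : smul x 0 = 0.
Proof. by rewrite -(scale0r (0 : A)) smulZr !scale0r. Qed.

Lemma smul0l (x : A) : smul 0 x = 0.
Proof. by rewrite -(scale0r (0 : A)) smulZl !scale0r. Qed.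

End StarAlgZero.

(** * Vacuum states of representations *)

Section VacuumState.
Variables (R : realType) (A : starAlgType R) (H : preHilbType R).
Variable pi : starHom A (adjOp H).

(** The unital extension of [pi] to the unitization, applied to the vacuum. *)
Definition orbit_map (x : unitization A) : H := x.1 *: Omega + pi x.2 Omega.

Lemma starRep_star a x y : inner (pi a x) y = inner x (pi (star a) y).
Proof. by rewrite starHomS -inner_star starK. Qed.

Lemma starRepM a b x : pi (smul a b) x = pi a (pi b x).
Proof. by rewrite starHomM smul_adjOpE. Qed.

Lemma starRepDr a x y : pi a (x + y) = pi a x + pi a y.
Proof. by have := (adjOpP (pi a)).1 1 x y; rewrite !scale1r. Qed.

Lemma starRepZr a (c : R[i]) x : pi a (c *: x) = c *: pi a x.
Proof.
have pi0 : pi a 0 = 0 by apply: (addrI (pi a 0)); rewrite -starRepDr !addr0.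
by have := (adjOpP (pi a)).1 c x 0; rewrite pi0 !addr0.
Qed.

Lemma orbit_map_linear : linear orbit_map.
Proof.
move=> c x y; rewrite /orbit_map /= linearP /= scalerDl scalerDr scalerA.
by rewrite addrACA.
Qed.

(** The extended representation moves across the inner product as its adjoint. This yields both the
    positivity of vacuum functionals and the isometry of [gns_arrow]. *)
Lemma inner_orbit_map x y : inner (orbit_map x) (orbit_map y) =
  unital_ext (fun a => inner Omega (pi a Omega)) (smul (star x) y).
Proof.
case: x y => [c a] [d b]; rewrite /orbit_map /unital_ext /=.
rewrite !innerDl !innerDr !innerZl !innerZr inner_Omega mulr1.
rewrite !linearD !linearZ /= !fctE !innerDr !innerZr.
by rewrite !starRep_star starRepM !addrA.
Qed.

Fact vacuum_linear : linear_for *%R (fun a => inner Omega (pi a Omega)).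
Proof. by move=> c a b; rewrite linearP /= innerDr innerZr. Qed.

Definition vacuum_fun : A -> R[i] := fun a => inner Omega (pi a Omega).
HB.instance Definition _ := GRing.isLinear.Build R[i] A R[i] *%R
  vacuum_fun vacuum_linear.

Fact vacuum_positive : positive (unital_ext vacuum_fun).
Proof. by move=> x; rewrite -inner_orbit_map inner_ge0. Qed.

Definition vacuum_state : state A := @State R A vacuum_fun vacuum_positive.

Lemma vacuum_stateE a : vacuum_state a = inner Omega (pi a Omega).
Proof. by []. Qed.

End VacuumState.

(** * The positive semidefinite form of a state *)

Section GNS.
Variables (R : realType) (A : starAlgType R) (phi : state A).
Local Notation U := (unitization A).
Implicit Types x y z : U.

Definition gns_form (x y : U) : R[i] := unital_ext phi (smul (star x) y).

Lemma unital_extP (c : R[i]) x y :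
  unital_ext phi (c *: x + y) = c * unital_ext phi x + unital_ext phi y.
Proof. by rewrite /unital_ext /= linearP /= mulrDr addrACA. Qed.

Lemma gns_formPr (c : R[i]) x y z :
  gns_form x (c *: y + z) = c * gns_form x y + gns_form x z.
Proof. by rewrite /gns_form smulDr smulZr unital_extP. Qed.

Lemma gns_formPl (c : R[i]) x y z :
  gns_form (c *: x + y) z = Num.conj c * gns_form x z + gns_form y z.
Proof. by rewrite /gns_form starD starZ smulDl smulZl unital_extP. Qed.

Lemma gns_form_ge0 x : 0 <= gns_form x x.
Proof. exact: state_positive. Qed.

Lemma gns_formDl x y z : gns_form (x + y) z = gns_form x z + gns_form y z.
Proof. by rewrite -{1}[x]scale1r gns_formPl conjC1 mul1r. Qed.

Lemma gns_form0l x : gns_form 0 x = 0.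
Proof. by apply: (addrI (gns_form 0 x)); rewrite -gns_formDl !addr0. Qed.

Lemma gns_formZl (c : R[i]) x y :
  gns_form (c *: x) y = Num.conj c * gns_form x y.
Proof. by rewrite -{1}[c *: x]addr0 gns_formPl gns_form0l addr0. Qed.

Lemma gns_formDr x y z : gns_form x (y + z) = gns_form x y + gns_form x z.
Proof. by rewrite -{1}[y]scale1r gns_formPr mul1r. Qed.

Lemma gns_form0r x : gns_form x 0 = 0.
Proof. by apply: (addrI (gns_form x 0)); rewrite -gns_formDr !addr0. Qed.

Lemma gns_formZr (c : R[i]) x y : gns_form x (c *: y) = c * gns_form x y.
Proof. by rewrite -{1}[c *: y]addr0 gns_formPr gns_form0r addr0. Qed.

(* Polarization: the values of the form at x + y and x + 'i y are real. *)
Lemma gns_formC x y : gns_form y x = Num.conj (gns_form x y).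
Proof.
have realF z : Num.conj (gns_form z z) = gns_form z z.
  by apply/CrealP/ger0_real/gns_form_ge0.
have := realF (x + 'i *: y); have := realF (x + y).
rewrite !(gns_formDl, gns_formDr, gns_formZl, gns_formZr).
move: (realF x) (realF y); move: {realF} (gns_form x x) (gns_form y y).
move: (gns_form x y) (gns_form y x) => a b p q pE qE.
rewrite !rmorphD /= !rmorphM /= !conjCK !conjCi pE qE => h1 h2.
have {}h1 : Num.conj a + Num.conj b = a + b.
  apply: (addrI (p + q)).
  transitivity (p + Num.conj a + (Num.conj b + q)); first by ring.
  by rewrite h1; ring.
have {h2} /(mulfI (neq0Ci _)) h2 :
    'i * (Num.conj b - Num.conj a) = 'i * (a - b).
  apply: (addrI (p + 'i * (- 'i * q))).
  transitivity (p + - 'i * Num.conj a + ('i * Num.conj b + 'i * (- 'i * q))).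
    by ring.
  by rewrite h2; ring.
have : 2 * b = 2 * Num.conj a.
  have -> : 2 * b = (a + b) - (a - b) by ring.
  by rewrite -h1 -h2; ring.
by apply: mulfI; rewrite pnatr_eq0.
Qed.

(** The degenerate case of Cauchy-Schwarz, which makes the inner product of the GNS space
    definite. *)
Lemma gns_form_eq0 x y : gns_form x x = 0 -> gns_form y x = 0.
Proof.
move=> x0; apply/eqP/contraT => c_neq0.
(* With t = - (<y,y> + 1) / (2 <y,x>), the squared norm of y + t x is -1. *)
set c := gns_form y x in c_neq0; set q := gns_form y y.
have cE : gns_form x y = Num.conj c by rewrite gns_formC.
have qE : Num.conj q = q by rewrite -gns_formC.
have := gns_form_ge0 (y + (- (q + 1) / (2 * c)) *: x).
rewrite !(gns_formDl, gns_formDr, gns_formZl, gns_formZr) x0 cE !mulr0 addr0.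
rewrite -(rmorphM Num.conj) /=.
have -> : - (q + 1) / (2 * c) * c = - (q + 1) / 2 by field.
rewrite fmorph_div rmorphN rmorphD /= qE conjC1 conjC_nat -/q.
have -> : q + - (q + 1) / 2 + - (q + 1) / 2 = -1 by field.
by rewrite oppr_ge0 ler10.
Qed.

(** * The GNS pre-Hilbert space *)

Definition gns_vec (x : U) : U -> R[i]^o := fun y => gns_form y x.

Lemma gns_vec_linear : linear gns_vec.
Proof. by move=> c x y; apply/funext => z; rewrite /gns_vec gns_formPr. Qed.

(* The GNS space is realised as the space of functionals y |-> phi(y* x) on   *)
(* the unitization, rather than as a quotient by the null vectors x: an       *)
(* algebra element a then acts by precomposition with a*.                     *)
Definition gns_pred : {pred (U -> R[i]^o)} :=
  fun f => `[< exists x, gns_vec x = f >].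

Fact gns_pred_closed : submod_closed gns_pred.
Proof.
split; first by apply/asboolP; exists 0; apply/funext => y; exact: gns_form0r.
move=> c f g /asboolP [x <-] /asboolP [y <-].
by apply/asboolP; exists (c *: x + y); rewrite gns_vec_linear.
Qed.
HB.instance Definition _ :=
  GRing.isSubmodClosed.Build R[i] (U -> R[i]^o) gns_pred gns_pred_closed.

Record gns_space := GNSVector {
  gns_fun :> U -> R[i]^o;
  gns_in : gns_fun \in gns_pred
}.
HB.instance Definition _ := [isSub for gns_fun].
HB.instance Definition _ := [Choice of gns_space by <:].
HB.instance Definition _ := [SubChoice_isSubLmodule of gns_space by <:].

Implicit Types f g h : gns_space.

Fact gns_repr_subproof f : exists x, gns_vec x = f.
Proof. by case: f => f /= /asboolP. Qed.

Definition gns_repr f : U := projT1 (cid (gns_repr_subproof f)).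

Lemma gns_reprK f y : gns_form y (gns_repr f) = f y.
Proof. by rewrite -[in RHS](projT2 (cid (gns_repr_subproof f))). Qed.

Fact gns_class_in x : gns_vec x \in gns_pred.
Proof. by apply/asboolP; exists x. Qed.

Definition gns_class x : gns_space := GNSVector (gns_class_in x).

Lemma gns_reprKf f : gns_class (gns_repr f) = f.
Proof. by apply: val_inj; apply/funext => y; exact: gns_reprK. Qed.

Lemma gns_classP (c : R[i]) x y :
  gns_class (c *: x + y) = c *: gns_class x + gns_class y.
Proof. by apply: val_inj; exact: gns_vec_linear. Qed.

Definition gns_inner f g : R[i] := g (gns_repr f).

(** Independence of the chosen representative: Hermitian symmetry moves it to the second slot, where
    [gns_reprK] replaces it by [x]. *)
Lemma gns_inner_class x y :
  gns_inner (gns_class x) (gns_class y) = gns_form x y.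
Proof.
by rewrite /gns_inner /= /gns_vec gns_formC gns_reprK /= /gns_vec -gns_formC.
Qed.

Fact gns_innerDr f g h : gns_inner f (g + h) = gns_inner f g + gns_inner f h.
Proof. by []. Qed.
Fact gns_innerZr f (c : R[i]) g : gns_inner f (c *: g) = c * gns_inner f g.
Proof. by []. Qed.
Fact gns_innerC f g : gns_inner g f = Num.conj (gns_inner f g).
Proof. by rewrite -[f]gns_reprKf -[g]gns_reprKf !gns_inner_class gns_formC. Qed.
Fact gns_inner_ge0 f : 0 <= gns_inner f f.
Proof. by rewrite -[f]gns_reprKf gns_inner_class gns_form_ge0. Qed.
Fact gns_inner_eq0 f : gns_inner f f = 0 -> f = 0.
Proof.
rewrite -[f]gns_reprKf gns_inner_class => f0.
by apply: val_inj; apply/funext => y; exact: gns_form_eq0.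
Qed.

Definition unit_elt : U := (1, 0).
Definition gns_Omega : gns_space := gns_class unit_elt.

Fact gns_inner_Omega : gns_inner gns_Omega gns_Omega = 1.
Proof.
rewrite gns_inner_class /gns_form /unit_elt /unital_ext /=.
by rewrite star0 !smul0r !scaler0 !addr0 linear0 conjC1 mulr1 addr0.
Qed.

HB.instance Definition _ := Lmodule_isPreHilb.Build R gns_space
  gns_innerDr gns_innerZr gns_innerC gns_inner_ge0 gns_inner_eq0
  gns_inner_Omega.

Lemma gns_OmegaE : (Omega : gns_space) = gns_class unit_elt.
Proof. by []. Qed.

Lemma inner_gns_class x y : inner (gns_class x) (gns_class y) = gns_form x y.
Proof. exact: gns_inner_class. Qed.

(** * The GNS representation *)

Definition of_alg (a : A) : U := (0, a).

Lemma star_of_alg a : star (of_alg a) = of_alg (star a).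
Proof. by congr pair; exact: conjC0. Qed.

Definition gns_act (a : A) f : gns_space :=
  gns_class (smul (of_alg a) (gns_repr f)).

(** The right-hand side involves no representative, so the action does not depend on the one chosen
    in [gns_act]. *)
Lemma gns_actE a f y : gns_act a f y = f (smul (of_alg (star a)) y).
Proof.
by rewrite /= /gns_vec -gns_reprK /gns_form starM star_of_alg starK smulA.
Qed.

Lemma gns_act_class a x :
  gns_act a (gns_class x) = gns_class (smul (of_alg a) x).
Proof.
apply: val_inj; apply/funext => y.
rewrite -[LHS]/(gns_act a (gns_class x) y) gns_actE /= /gns_vec /gns_form.
by rewrite starM star_of_alg starK smulA.
Qed.

Lemma gns_act_adjoint a : is_adjoint (gns_act a) (gns_act (star a)).
Proof.
move=> f g; rewrite -[f]gns_reprKf -[g]gns_reprKf !gns_act_class.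
by rewrite !inner_gns_class /gns_form starM star_of_alg starK smulA.
Qed.

Fact gns_act_in a : gns_act a \in adjointable_pred (H := gns_space).
Proof.
apply/asboolP; split; last by exists (gns_act (star a)); exact: gns_act_adjoint.
(* Linearity comes from adjointness: [gns_act a] is an adjoint of [gns_act (star a)]. *)
have /is_adjoint_sym := gns_act_adjoint a; exact: is_adjoint_linear.
Qed.

Definition gns_op (a : A) : adjOp gns_space := AdjOp (gns_act_in a).

Fact gns_op_linear : linear gns_op.
Proof.
move=> c a b; apply: val_inj; apply/funext => f; rewrite /= !fctE /= /gns_act.
rewrite -gns_classP; congr gns_class; rewrite -smulZl -smulDl; congr smul.
by congr pair; rewrite /= ?scaler0 ?addr0.
Qed.
HB.instance Definition _ := GRing.isLinear.Build R[i] A (adjOp gns_space) *:%R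
  gns_op gns_op_linear.

Fact gns_opM : {morph gns_op : a b / smul a b}.
Proof.
move=> a b; apply: val_inj; apply/funext => f; rewrite /= /gns_act.
rewrite -/(gns_act a _) gns_act_class smulA; congr gns_class; congr smul.
by congr pair; rewrite /= ?mul0r // !scale0r !add0r.
Qed.

Fact gns_opS : {morph gns_op : a / star a}.
Proof.
move=> a; apply: val_inj; apply: (is_adjoint_uniq (f := gns_op a)).
  exact: gns_act_adjoint.
exact: inner_star.
Qed.

Definition gns_rep : starHom A (adjOp gns_space) :=
  @StarHom R A (adjOp gns_space) gns_op gns_opM gns_opS.

Lemma gns_rep_vacuum a : phi a = inner Omega (gns_rep a Omega).
Proof.
rewrite gns_OmegaE /= gns_act_class inner_gns_class /gns_form /unital_ext /=.
rewrite smul0r star0 smul0l conjC1 !scale1r !mul0r mulr0 !scale0r.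
by rewrite !addr0 !add0r.
Qed.

(** * The isometry from the GNS space into any representation with the same vacuum state *)

Section Universal.
Variables (H : preHilbType R) (pi : starHom A (adjOp H)).
Hypothesis piE : forall a, phi a = inner Omega (pi a Omega).

Lemma inner_orbit_map_gns x y :
  inner (orbit_map pi x) (orbit_map pi y) = gns_form x y.
Proof. by rewrite inner_orbit_map /gns_form /unital_ext /= piE. Qed.

Definition gns_arrow_fun (f : gns_space) : H := orbit_map pi (gns_repr f).

(** Two representatives of a class differ by a null vector of the form, and [orbit_map] preserves
    the form, so their images differ by a vector of norm zero. *)
Lemma gns_arrow_class x : gns_arrow_fun (gns_class x) = orbit_map pi x.
Proof.
apply/eqP; rewrite -subr_eq0; apply/eqP/inner_eq0.
have -> : gns_arrow_fun (gns_class x) - orbit_map pi x =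
    orbit_map pi ((-1) *: x + gns_repr (gns_class x)).
  by rewrite orbit_map_linear scaleN1r addrC.
by rewrite inner_orbit_map_gns gns_formPr gns_reprK /= /gns_vec mulN1r addNr.
Qed.

Fact gns_arrow_linear : linear gns_arrow_fun.
Proof.
move=> c f g; rewrite -[f]gns_reprKf -[g]gns_reprKf -gns_classP.
by rewrite !gns_arrow_class orbit_map_linear.
Qed.
HB.instance Definition _ := GRing.isLinear.Build R[i] gns_space H *:%R
  gns_arrow_fun gns_arrow_linear.

Fact gns_arrow_inner f g :
  inner (gns_arrow_fun f) (gns_arrow_fun g) = inner f g.
Proof. by rewrite inner_orbit_map_gns -inner_gns_class !gns_reprKf. Qed.

Fact gns_arrow_Omega : gns_arrow_fun Omega = Omega.
Proof.
by rewrite gns_OmegaE gns_arrow_class /orbit_map /= scale1r linear0 addr0.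
Qed.

Definition gns_arrow : arrow gns_space H :=
  @Arrow R gns_space H gns_arrow_fun gns_arrow_inner gns_arrow_Omega.

(** On the class of [x], both sides are the orbit vector of the product of [a] and [x] in the
    unitization. *)
Lemma gns_arrow_intertwines a f : gns_arrow (gns_rep a f) = pi a (gns_arrow f).
Proof.
rewrite -[f]gns_reprKf /= gns_act_class !gns_arrow_class /orbit_map /=.
rewrite mul0r !scale0r !add0r starRepDr starRepZr -starRepM.
by rewrite linearD linearZ.
Qed.

End Universal.

End GNS.

(** * The product of states and its axioms *)

Section StateProduct.
Variables (R : realType) (m : nat) (T : monProd R) (odot : repOp m T).
Hypothesis odotP : universal_rep_product odot.

Definition state_odot : stateOp R m := fun A1 A2 phi1 phi2 =>
  vacuum_state (odot (gns_rep phi1) (gns_rep phi2)).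

Lemma state_odotE (A1 A2 : mFaced R m) (phi1 : state A1) (phi2 : state A2)
    (H1 H2 : preHilbType R) (pi1 : starHom A1 (adjOp H1))
    (pi2 : starHom A2 (adjOp H2)) :
  (forall a, phi1 a = inner Omega (pi1 a Omega)) ->
  (forall a, phi2 a = inner Omega (pi2 a Omega)) ->
  forall a : mfProd A1 A2, state_odot phi1 phi2 a =
    inner Omega (odot pi1 pi2 a Omega).
Proof.
move=> pi1E pi2E a; set W := tensA T (gns_arrow pi1E) (gns_arrow pi2E).
have WE := urp_universal_hilb odotP (gns_arrow_intertwines pi1E)
  (gns_arrow_intertwines pi2E) a Omega.
by rewrite -(arrow_Omega W) -[X in inner _ X]WE arrow_inner.
Qed.

Lemma state_odot_universal : universal_state_product state_odot.
Proof.
split.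
- move=> A1 A2 A3 phi1 phi2 phi3 a.
  (* The inner products of states are vacuum states of products of GNS representations, so these
     products can replace their own GNS representations. *)
  rewrite (state_odotE (gns_rep_vacuum phi1)
    (vacuum_stateE (odot (gns_rep phi2) (gns_rep phi3)))).
  rewrite (state_odotE (vacuum_stateE (odot (gns_rep phi1) (gns_rep phi2)))
    (gns_rep_vacuum phi3)).
  pose W := assoc T (gns_space phi1) (gns_space phi2) (gns_space phi3).
  by rewrite -(arrow_Omega W) (urp_assoc odotP) arrow_inner.
- move=> A1 A2 B1 B2 j1 j2 phi1 phi2 b.
  (* The pulled-back states are represented on the GNS spaces of [phi1] and [phi2] themselves. *)
  rewrite (state_odotE (pi1 := starHom_comp (gns_rep phi1) j1)
    (pi2 := starHom_comp (gns_rep phi2) j2)).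
  + by rewrite -(urp_universal_alg odotP).
  + by move=> a; exact: (gns_rep_vacuum phi1 (j1 a)).
  + by move=> a; exact: (gns_rep_vacuum phi2 (j2 a)).
- move=> A1 A2 phi1 phi2 a; rewrite [RHS]gns_rep_vacuum.
  rewrite vacuum_stateE.
  (* The vacuum of the product lies in the embedded factor, where the restriction axiom applies. *)
  rewrite -(arrow_Omega (emb1 T (gns_space phi1) (gns_space phi2))).
  by rewrite (urp_restr1 odotP) arrow_inner.
- move=> A1 A2 phi1 phi2 a; rewrite [RHS]gns_rep_vacuum.
  rewrite vacuum_stateE.
  rewrite -(arrow_Omega (emb2 T (gns_space phi1) (gns_space phi2))).
  by rewrite (urp_restr2 odotP) arrow_inner.
Qed.

End StateProduct.

Theorem theorem4p9 (R : realType) (m : nat) (T : monProd R)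
    (odot : repOp m T) (odotP : universal_rep_product odot) :
  exists2 sodot : stateOp R m, universal_state_product sodot &
    forall (A1 A2 : mFaced R m) (phi1 : state A1) (phi2 : state A2)
      (H1 H2 : preHilbType R) (pi1 : starRep A1 H1) (pi2 : starRep A2 H2),
    (forall a : A1, phi1 a = inner Omega (pi1 a Omega)) ->
    (forall a : A2, phi2 a = inner Omega (pi2 a Omega)) ->
    forall a : mfProd A1 A2,
      sodot A1 A2 phi1 phi2 a =
      inner Omega (odot A1 A2 H1 H2 pi1 pi2 a Omega).
Proof.
exists (state_odot odot); first exact: state_odot_universal.
by move=> A1 A2 phi1 phi2 H1 H2 pi1 pi2; exact: state_odotE.
Qed.
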